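(* Let $r$ and $s$ be positive integers with $r \geq s \geq 2$ and $r \leq 2s - 2$. Then $f(s,r,2) = 4s + r - 3$.
   Context: For integers $a\le b$, $[a,b]=\{n\in\mathbb{N} : a\le n\le b\}$. For a finite set $X\subseteq\mathbb{N}$, $\mathrm{diam}(X)=\max(X)-\min(X)$. A set is monochromatic under a coloring $\Delta$ if all its elements receive the same color. For positive integers $s,r,k$, $f(s,r,k)$ denotes the smallest positive integer $n$ such that for every coloring $\Delta:[1,n]\to\{1,\dots,k\}$ there exist subsets $S_1,S_2\subseteq[1,n]$ with: (a) $S_1$ and $S_2$ each monochromatic (not necessarily of the same color); (b) $|S_1|=s$, $|S_2|=r$; (c) $\max(S_1)<\min(S_2)$; (d) $\mathrm{diam}(S_1)\le\mathrm{diam}(S_2)$. *)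

(* Defs.v *)
From mathcomp Require Import all_boot.
From mathcomp Require Import finmap.

Set Implicit Arguments.
Unset Strict Implicit.
Unset Printing Implicit Defensive.

Local Open Scope fset_scope.

Definition nat_itv (a b : nat) : {fset nat} := [fset x in index_iota a b.+1].

Definition maxS (X : {fset nat}) : nat := \max_(x <- X) x.

(* Starting the iterated minimum at [maxS X] yields the minimum of any nonempty
   X; on the empty set maxS and minS are both 0, a value never used below
   because the sets considered have positive cardinality. *)
Definition minS (X : {fset nat}) : nat := \big[minn/maxS X]_(x <- X) x.

Definition diam (X : {fset nat}) : nat := maxS X - minS X.

Definition monochromatic (Delta : nat -> nat) (X : {fset nat}) : Prop :=
  {in X &, forall x y, Delta x = Delta y}.

(* A coloring of [1,n] is represented by a function on nat, only its values on
   [1,n] being constrained and used. *)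
Definition coloring (n k : nat) (Delta : nat -> nat) : Prop :=
  {in nat_itv 1 n, forall x, Delta x \in nat_itv 1 k}.

Definition unavoidable (s r k n : nat) : Prop :=
  forall Delta : nat -> nat, coloring n k Delta ->
  exists S1 S2 : {fset nat},
    [/\ S1 `<=` nat_itv 1 n, S2 `<=` nat_itv 1 n &
    [/\ monochromatic Delta S1 /\ monochromatic Delta S2,
        #|` S1| = s /\ #|` S2| = r,
        maxS S1 < minS S2
      & diam S1 <= diam S2]].

(* [is_f s r k n] reads "f(s,r,k) = n".  It is a relation because no such n
   exists for some parameters (e.g. r = 1 < s). *)
Definition is_f (s r k n : nat) : Prop :=
  [/\ 0 < n, unavoidable s r k n
    & forall m, 0 < m -> unavoidable s r k m -> n <= m].

(* Main.v *)
Require Import Defs.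
From mathcomp Require Import all_boot.
From mathcomp Require Import finmap zify.

(** Upper bound: by pigeonhole [1, 2s-1] contains a monochromatic s-set S1,
    necessarily of diameter at most 2s-2, so it is enough to find a color class
    of the remaining interval J = [2s, n], n = 4s+r-3, with at least r elements
    and diameter at least 2s-2.  If one class of J has fewer than r elements, the
    other has at least 2s-1 and works.  If both have at least r elements and
    neither works, the class of 2s misses the last r points of J and the other
    class misses the first r; these two monochromatic runs then give S1 and S2.

    Lower bound: color [1, n-1] by alternating blocks of lengths s-1, s-1, 2s-1
    and r-1.  The sets S1 and S2 are forced into the color of the odd blocks,
    with S2 in the third one; counting S1 gives diam S1 >= 2s-2 > diam S2. *)

Set Implicit Arguments.
Unset Strict Implicit.
Unset Printing Implicit Defensive.

Local Open Scope fset_scope.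

(** * Intervals, extrema and diameters of finite sets *)

Lemma in_nat_itv a b x : (x \in nat_itv a b) = (a <= x <= b).
Proof. by rewrite !inE mem_index_iota ltnS. Qed.

Lemma card_nat_itv a b : #|` nat_itv a b| = b.+1 - a.
Proof. by rewrite card_fseq undup_id ?iota_uniq // size_iota. Qed.

Lemma leq_card_nat_itv (X : {fset nat}) a b :
  {in X, forall x, a <= x <= b} -> #|` X| <= b.+1 - a.
Proof.
move=> Xab; rewrite -card_nat_itv; apply/fsubset_leq_card/fsubsetP => x /Xab.
by rewrite in_nat_itv.
Qed.

Lemma leq_maxS (X : {fset nat}) x : x \in X -> x <= maxS X.
Proof. by move=> xX; rewrite /maxS (big_rem x) //= leq_maxl. Qed.

Lemma maxS_leq (X : {fset nat}) b : {in X, forall x, x <= b} -> maxS X <= b.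
Proof. by move=> Xb; apply/bigmax_leqP_seq => x /Xb. Qed.

(** [minn] has no neutral element on [nat], so the start value [d] counts as one more member of the
    minimum. *)
Lemma leq_bigminn (d m : nat) (t : seq nat) :
  (m <= \big[minn/d]_(x <- t) x) = (m <= d) && all (leq m) t.
Proof.
elim: t => [|x t IH]; first by rewrite big_nil andbT.
by rewrite big_cons leq_min IH /= andbCA.
Qed.

Lemma minS_leq (X : {fset nat}) x : x \in X -> minS X <= x.
Proof.
move=> xX; have := leqnn (minS X); rewrite {2}/minS leq_bigminn.
by case/andP=> _ /allP; apply.
Qed.

Lemma maxS_mem (X : {fset nat}) x : x \in X -> maxS X \in X.
Proof.
(* The empty maximum is 0, hence the extra member 0. If the maximum of [X] is 0, then [x <= 0]
   forces [x] to be that maximum. *)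
suff bigmax_mem (t : seq nat) : \max_(y <- t) y \in 0 :: t.
  move=> xX; have := bigmax_mem X; rewrite in_cons => /orP[/eqP max0|//].
  suff -> : maxS X = x by [].
  by have := leq_maxS xX; rewrite /maxS max0 leqn0 => /eqP.
elim: t => [|y t IH]; rewrite ?big_nil // big_cons.
case: leqP => _; first by move: IH; rewrite !in_cons => /orP[]->; rewrite ?orbT.
by rewrite !in_cons eqxx orbT.
Qed.

(** The start value [maxS X] already lies in [X], and [minn] returns one of its arguments. *)
Lemma minS_mem (X : {fset nat}) x : x \in X -> minS X \in X.
Proof.
move=> /maxS_mem dX; rewrite /minS big_seq.
apply: (big_ind (fun y => y \in X)) => // y z yX zX.
by rewrite /minn; case: ifP.
Qed.

Lemma leq_minS (X : {fset nat}) x a :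
  x \in X -> {in X, forall y, a <= y} -> a <= minS X.
Proof. by move=> /minS_mem mX; apply. Qed.

Lemma leq_diam (X : {fset nat}) x y : x \in X -> y \in X -> y - x <= diam X.
Proof. by move=> /minS_leq ? /leq_maxS ?; rewrite /diam; lia. Qed.

Lemma fset_subset_card (X : {fset nat}) k :
  k <= #|` X| -> exists2 S : {fset nat}, S `<=` X & #|` S| = k.
Proof.
move=> kX; exists [fset z in take k X].
  by apply/fsubsetP=> z; rewrite inE => /mem_take.
by rewrite card_fseq undup_id ?take_uniq ?fset_uniq // size_takel.
Qed.

(** Keeping two chosen points while thinning [X] to [k] elements preserves a lower bound on the
    diameter. The other [k - 2] points come from the rest of [X]. *)
Lemma fset_subset_card_pair (X : {fset nat}) x y k :
  x \in X -> y \in X -> x != y -> 2 <= k <= #|` X| ->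
  exists S : {fset nat}, [/\ S `<=` X, #|` S| = k, x \in S & y \in S].
Proof.
move=> xX yX nxy /andP[k2 kX].
have cY : (#|` X `\ x `\ y|).+2 = #|` X|.
  by rewrite (cardfsD1 x X) xX (cardfsD1 y (X `\ x)) !inE yX eq_sym nxy.
have [|S' /fsubsetP S'Y cS'] := @fset_subset_card (X `\ x `\ y) (k - 2).
  by lia.
have [xS' yS'] : x \notin S' /\ y \notin S'.
  by split; apply/negP => /S'Y; rewrite !inE eqxx ?andbF.
exists (x |` (y |` S')); split; rewrite ?inE ?eqxx ?orbT //.
- apply/fsubsetP=> z; rewrite !inE => /or3P[/eqP->|/eqP->|/S'Y] //.
  by rewrite !inE => /and3P[].
- by rewrite !cardfsU1 !inE negb_or nxy xS' yS' cS' /=; lia.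
Qed.

(** * Color classes *)

Definition color_class (Delta : nat -> nat) (a b c : nat) : {fset nat} :=
  [fset x in nat_itv a b | Delta x == c].

Lemma in_color_class Delta a b c x :
  (x \in color_class Delta a b c) = (a <= x <= b) && (Delta x == c).
Proof. by rewrite !inE mem_index_iota ltnS. Qed.

Lemma color_class_monochromatic Delta a b c (S : {fset nat}) :
  S `<=` color_class Delta a b c -> monochromatic Delta S.
Proof.
move=> /fsubsetP SC x y /SC; rewrite in_color_class => /andP[_ /eqP->] /SC.
by rewrite in_color_class => /andP[_ /eqP->].
Qed.

Lemma card_color_classD Delta a b c d :
  {in nat_itv a b, forall x, Delta x = c \/ Delta x = d} ->
  b.+1 - a <= #|` color_class Delta a b c| + #|` color_class Delta a b d|.
Proof.
move=> cd; rewrite -card_nat_itv.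
(* The classes overlap when [c = d], so the intersection term is dropped and only an inequality
   remains. *)
rewrite -cardfsUI; apply: leq_trans (leq_addr _ _).
apply/fsubset_leq_card/fsubsetP => x xab; rewrite in_fsetU !in_color_class.
by rewrite -in_nat_itv xab; case: (cd x xab) => ->; rewrite eqxx ?orbT.
Qed.

(** * Upper bound *)

Lemma unavoidable_upper r s : 2 <= s -> s <= r -> r <= 2 * s - 2 ->
  unavoidable s r 2 (4 * s + r - 3).
Proof.
move=> hs hrs hr Delta colD; set n := 4 * s + r - 3.
set goal := (ex _).
have D12 x : 1 <= x <= n -> Delta x = 1 \/ Delta x = 2.
  by rewrite -in_nat_itv => /colD; rewrite in_nat_itv; lia.
have [S1 S1sub [S1mono cS1]] : exists2 S1 : {fset nat},
    S1 `<=` nat_itv 1 (2 * s - 1) & monochromatic Delta S1 /\ #|` S1| = s.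
  have [c sc] : exists c, s <= #|` color_class Delta 1 (2 * s - 1) c|.
    have := @card_color_classD Delta 1 (2 * s - 1) 1 2.
    set c1 := #|` _|; set c2 := #|` _| => c12.
    have {}c12 : s <= c1 \/ s <= c2.
      have: (2 * s - 1).+1 - 1 <= c1 + c2.
        by apply: c12 => x; rewrite in_nat_itv => ?; apply: D12; lia.
      lia.
    by case: c12 => ?; [exists 1|exists 2].
  have [S1 S1C cS1] := fset_subset_card sc.
  exists S1; last by split=> //; apply: color_class_monochromatic S1C.
  apply/fsubsetP => x /(fsubsetP S1C).
  by rewrite in_color_class in_nat_itv => /andP[].
have [S1le S1ge] : {in S1, forall x, x <= 2 * s - 1} /\ {in S1, forall x, 1 <= x}.
  by split=> x /(fsubsetP S1sub); rewrite in_nat_itv => /andP[].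
have [x0 x0S1] : exists x, x \in S1.
  by apply/fset0Pn; rewrite -cardfs_gt0 cS1; lia.
(* An [r]-subset of the class through [x] and [y] has diameter at least [2 * s - 2], so it can
   follow [S1]. *)
have far_pair c x y : x \in color_class Delta (2 * s) n c ->
    y \in color_class Delta (2 * s) n c -> 2 * s - 2 <= y - x ->
    r <= #|` color_class Delta (2 * s) n c| -> goal.
  move=> xC yC xy rC.
  have [||S2 [S2C cS2 xS2 yS2]] := @fset_subset_card_pair _ x y r xC yC.
  - by apply/eqP; lia.
  - by lia.
  have S2b z : z \in S2 -> 2 * s <= z <= n.
    by move=> /(fsubsetP S2C); rewrite in_color_class => /andP[].
  exists S1, S2; split; [| |split] => //.
  - by apply/fsubsetP => z zS; rewrite in_nat_itv S1ge //=; have := S1le z zS; lia.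
  - by apply/fsubsetP => z /S2b; rewrite in_nat_itv; lia.
  - by split=> //; apply: color_class_monochromatic S2C.
  - have := maxS_leq S1le.
    have := @leq_minS S2 x (2 * s) xS2 (fun z zS => proj1 (andP (S2b z zS))).
    lia.
  - have := maxS_leq S1le; have := leq_minS x0S1 S1ge.
    have := leq_diam xS2 yS2; rewrite {2}/diam; lia.
(* The extreme points of such a class are at least [2 * s - 2] apart, and [r < 2 * s - 1]. *)
have large_class c : 2 * s - 1 <= #|` color_class Delta (2 * s) n c| -> goal.
  move=> cC; have [x xC] : exists x, x \in color_class Delta (2 * s) n c.
    by apply/fset0Pn; rewrite -cardfs_gt0; lia.
  apply: (far_pair c _ _ (minS_mem xC) (maxS_mem xC)); last by lia.
  have := @leq_card_nat_itv (color_class Delta (2 * s) n c)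
    (minS (color_class Delta (2 * s) n c)) (maxS (color_class Delta (2 * s) n c)).
  move/(_ (fun z zC => introT andP (conj (minS_leq zC) (leq_maxS zC)))); lia.
have [a [b [Da Dab]]] : exists a b, Delta (2 * s) = a /\
    forall x, 1 <= x <= n -> Delta x = a \/ Delta x = b.
  case: (D12 (2 * s)); rewrite /n ?hs; first lia.
  - by exists 1, 2.
  - by exists 2, 1; split=> // x /D12 [] ->; [right|left].
(* The total is [(r - 1) + (2 * s - 1)]: a class with fewer than [r] points leaves [2 * s - 1] to
   the other. *)
have cards : 2 * s + r - 2 <= #|` color_class Delta (2 * s) n a|
    + #|` color_class Delta (2 * s) n b|.
  have := @card_color_classD Delta (2 * s) n a b.
  have -> : n.+1 - 2 * s = 2 * s + r - 2 by rewrite /n; lia.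
  by apply=> x; rewrite in_nat_itv => ?; apply: Dab; lia.
have [rA|] := leqP r #|` color_class Delta (2 * s) n a|; last first.
  by move=> ?; apply: (large_class b); lia.
have [rB|] := leqP r #|` color_class Delta (2 * s) n b|; last first.
  by move=> ?; apply: (large_class a); lia.
(* From [4 * s - 2] on, points are at distance at least [2 * s - 2] from [2 * s]; up to [n] there
   are exactly [r] of them. *)
have [/allP topB|/allPn[y]] :=
    boolP (all (fun y => Delta y != a) (nat_itv (4 * s - 2) n)); last first.
  rewrite in_nat_itv negbK => yn ya.
  by apply: (far_pair a (2 * s) y) => //; rewrite ?in_color_class ?Da ?ya ?eqxx; lia.
(* Symmetrically, the first [r] points are at distance at least [2 * s - 2] from [n], which has
   color [b] by [topB]. *)
have [/allP lowA|/allPn[x]] :=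
    boolP (all (fun x => Delta x != b) (nat_itv (2 * s) (2 * s + r - 1)));
    last first.
  rewrite in_nat_itv negbK => xn xb.
  have nb : Delta n = b.
    have /topB/eqP na : n \in nat_itv (4 * s - 2) n by rewrite in_nat_itv /n; lia.
    by case: (Dab n) => //; rewrite /n; lia.
  by apply: (far_pair b x n) => //; rewrite ?in_color_class ?nb ?xb ?eqxx /n; lia.
(* The first [s] points of the low run, which fit since [s <= r], and the whole top run: the
   diameters are [s - 1] and [r - 1], and [3 * s - 1 < 4 * s - 2]. *)
exists (nat_itv (2 * s) (3 * s - 1)), (nat_itv (4 * s - 2) n).
have l1 : 2 * s \in nat_itv (2 * s) (3 * s - 1) by rewrite in_nat_itv; lia.
have u1 : maxS (nat_itv (2 * s) (3 * s - 1)) <= 3 * s - 1.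
  by apply: maxS_leq => x; rewrite in_nat_itv => /andP[].
have m1 : 2 * s <= minS (nat_itv (2 * s) (3 * s - 1)).
  by apply: leq_minS l1 _ => x; rewrite in_nat_itv => /andP[].
have l2 : 4 * s - 2 \in nat_itv (4 * s - 2) n by rewrite in_nat_itv /n; lia.
have u2 : n \in nat_itv (4 * s - 2) n by rewrite in_nat_itv /n; lia.
have m2 : 4 * s - 2 <= minS (nat_itv (4 * s - 2) n).
  by apply: leq_minS l2 _ => x; rewrite in_nat_itv => /andP[].
split; [| |split].
- by apply/fsubsetP=> x; rewrite !in_nat_itv /n; lia.
- by apply/fsubsetP=> x; rewrite !in_nat_itv /n; lia.
- have low x : x \in nat_itv (2 * s) (3 * s - 1) -> Delta x = a.
    rewrite in_nat_itv => xs; have /lowA/eqP xb : x \in nat_itv (2 * s) (2 * s + r - 1).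
      by rewrite in_nat_itv; lia.
    by case: (Dab x) => //; rewrite /n; lia.
  have top x : x \in nat_itv (4 * s - 2) n -> Delta x = b.
    move=> xn; have /eqP xa := topB x xn; move: xn; rewrite in_nat_itv => xn.
    by case: (Dab x) => //; lia.
  by split=> x y; [move=> /low -> /low ->|move=> /top -> /top ->].
- by rewrite !card_nat_itv /n; split; lia.
- lia.
- by have := leq_diam l2 u2; rewrite {2}/diam /n; lia.
Qed.

(** * Lower bound *)

Definition block_coloring (s x : nat) : nat :=
  if (x <= s - 1) || (2 * s - 1 <= x <= 4 * s - 3) then 1 else 2.

(** The coloring is independent of [m], so one coloring excludes every value below the claimed
    one. *)
Lemma block_coloring_avoids r s m : 2 <= s -> s <= r ->
  m <= 4 * s + r - 4 -> ~ unavoidable s r 2 m.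
Proof.
move=> hs hrs hm /(_ (block_coloring s)) [|S1 [S2 [/fsubsetP sub1 /fsubsetP sub2]]].
  by move=> x _; rewrite /block_coloring in_nat_itv; case: ifP.
case=> [[mono1 mono2] [c1 c2] sep dia].
have [x1 x1S] : exists x, x \in S1.
  by apply/fset0Pn; rewrite -cardfs_gt0 c1; lia.
have [x2 x2S] : exists x, x \in S2.
  by apply/fset0Pn; rewrite -cardfs_gt0 c2; lia.
have b1 x : x \in S1 -> [/\ 1 <= x, minS S1 <= x & x <= maxS S1].
  move=> xS; split; [|exact: minS_leq|exact: leq_maxS].
  by have := sub1 x xS; rewrite in_nat_itv => /andP[].
have b2 x : x \in S2 -> maxS S1 < x <= 4 * s + r - 4.
  by move=> xS; have := sub2 x xS; rewrite in_nat_itv; have := minS_leq xS; lia.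
have col x : block_coloring s x = 1 <->
    (x <= s - 1 \/ 2 * s - 1 <= x <= 4 * s - 3).
  by rewrite /block_coloring; case: ifP; lia.
(* The fourth block has at most [r - 1] points. *)
have late2 : ~ {in S2, forall x, 4 * s - 2 <= x}.
  move=> lateS; have := @leq_card_nat_itv S2 (4 * s - 2) (4 * s + r - 4).
  rewrite c2; suff ge x : x \in S2 -> 4 * s - 2 <= x <= 4 * s + r - 4.
    by move/(_ ge); lia.
  by move=> xS; rewrite lateS //; have := b2 x xS; lia.
(* In color 2, [S1] overflows the second block, of [s - 1] points, into the fourth, and then [S2]
   lies wholly in the fourth. *)
case: (eqVneq (block_coloring s x1) 1) => [col1|/eqP col1]; last first.
  have max1 : 4 * s - 2 <= maxS S1.
    rewrite leqNgt; apply/negP => lt_max.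
    have := @leq_card_nat_itv S1 s (2 * s - 2); rewrite c1.
    suff le x : x \in S1 -> s <= x <= 2 * s - 2 by move/(_ le); lia.
    move=> xS; have : block_coloring s x <> 1 by rewrite (mono1 x x1).
    by rewrite col; case: (b1 x xS); lia.
  by apply: late2 => x /b2; lia.
have in1 x : x \in S1 -> x <= s - 1 \/ 2 * s - 1 <= x <= 4 * s - 3.
  by move=> xS; apply/col; rewrite (mono1 x x1).
have max1 : 2 * s - 1 <= maxS S1.
  rewrite leqNgt; apply/negP => lt_max.
  have := @leq_card_nat_itv S1 1 (s - 1); rewrite c1.
  suff le x : x \in S1 -> 1 <= x <= s - 1 by move/(_ le); lia.
  by move=> xS; have := in1 x xS; case: (b1 x xS); lia.
(* Past [2 * s - 1], color 2 occurs only in the fourth block, which cannot hold all of [S2]. *)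
have in2 x : x \in S2 -> x <= 4 * s - 3.
  case: (eqVneq (block_coloring s x2) 1) => [col2|/eqP col2] xS.
    have /col : block_coloring s x = 1 by rewrite (mono2 x x2).
    by have := b2 x xS; lia.
  case: late2 => y yS; have : block_coloring s y <> 1 by rewrite (mono2 y x2).
  by rewrite col; have := b2 y yS; lia.
have card2 : r <= 4 * s - 3 - maxS S1.
  have := @leq_card_nat_itv S2 (maxS S1).+1 (4 * s - 3); rewrite c2.
  suff le x : x \in S2 -> maxS S1 < x <= 4 * s - 3 by move/(_ le); lia.
  by move=> xS; have := in2 x xS; have := b2 x xS; lia.
(* [S1] lies in the first and third blocks, cut at its own extrema; the first term truncates to 0
   when [S1] misses the first block. *)
have card1 : s <= (s - minS S1) + ((maxS S1).+1 - (2 * s - 1)).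
  have := card_nat_itv (minS S1) (s - 1).
  have := card_nat_itv (2 * s - 1) (maxS S1).
  have := cardfsUI (nat_itv (minS S1) (s - 1)) (nat_itv (2 * s - 1) (maxS S1)).
  suff /fsubset_leq_card : S1 `<=`
    nat_itv (minS S1) (s - 1) `|` nat_itv (2 * s - 1) (maxS S1) by rewrite c1; lia.
  apply/fsubsetP => x xS; rewrite in_fsetU !in_nat_itv.
  by have := in1 x xS; case: (b1 x xS); lia.
have max2 : maxS S2 <= 4 * s - 3 by apply: maxS_leq.
(* If [minS S1 >= s], then [card1] gives [maxS S1 >= 3 * s - 2] and [card2] gives [r < s]. Otherwise
   [card1] gives [diam S1 >= 2 * s - 2], while [S2] lies in [[2s, 4s-3]]. *)
by move: dia; rewrite /diam; lia.
Qed.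


Theorem theorem3p2 (r s : nat) (hs : 2 <= s) (hrs : s <= r)
  (hr : r <= 2 * s - 2) : is_f s r 2 (4 * s + r - 3).
Proof.
split; [lia|exact: unavoidable_upper|move=> m _ um; rewrite leqNgt].
apply/negP=> lt_m; apply: (@block_coloring_avoids r s m) um => //; lia.
Qed.
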